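(* Let $G$ and $H$ be groups belonging to $CS$, i.e. $G$ and $H$ are nontrivial finite groups with $\mathrm{Soc}(G)\leq Z(G)$ and $\mathrm{Soc}(H)\leq Z(H)$. Then $\mu(G\times H)=\mu(G)+\mu(H)$.
   Context: For a finite group $G$, $\mu(G)$ denotes the least positive integer $n$ such that $G$ embeds in the symmetric group $S_n$. The socle $\mathrm{Soc}(G)$ of a finite group $G$ is the subgroup generated by all minimal (nontrivial) normal subgroups of $G$, and $Z(G)$ is the center of $G$. $CS$ is the collection of all nontrivial finite groups $G$ with $\mathrm{Soc}(G)\leq Z(G)$. *)

(* Defs.v *)
From HB Require Import structures.
From mathcomp Require Import all_boot all_order all_fingroup all_solvable.

Set Implicit Arguments.
Unset Strict Implicit.
Unset Printing Implicit Defensive.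
Import GroupScope.

Definition embeds_Sym (gT : finGroupType) (G : {group gT}) (n : nat) : bool :=
  [exists K : {group 'S_n}, G \isog K].

Lemma embeds_SymP (gT : finGroupType) (G : {group gT}) (n : nat) :
  reflect (exists f : {morphism G >-> 'S_n}, 'injm f) (embeds_Sym G n).
Proof.
apply: (iffP existsP) => [[K /isogP[f injf _]]|[f injf]]; first by exists f.
by exists (f @* G)%G; apply/isogP; exists f.
Qed.

(* The right regular action of gT, transported along the enumeration of gT;
   used only to show that the minimum defining mu exists. *)
Definition cayley_act (gT : finGroupType) (i : 'I_#|gT|) (x : gT) : 'I_#|gT| :=
  enum_rank (enum_val i * x).

Lemma cayley_act1 (gT : finGroupType) : (@cayley_act gT)^~ 1 =1 id.
Proof. by move=> i; rewrite /cayley_act mulg1 enum_valK. Qed.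

Lemma cayley_actM (gT : finGroupType) i : act_morph (@cayley_act gT) i.
Proof. by move=> x y; rewrite /cayley_act enum_rankK mulgA. Qed.

Definition cayley_action (gT : finGroupType) :=
  TotalAction (@cayley_act1 gT) (@cayley_actM gT).

Lemma embeds_Sym_exists (gT : finGroupType) (G : {group gT}) :
  exists n, (0 < n) && embeds_Sym G n.
Proof.
exists #|gT|; apply/andP; split; first by apply/card_gt0P; exists 1.
have inj : 'injm (actperm (cayley_action gT)).
  apply/injmP => x y _ _ /permP/(_ (enum_rank 1)).
  rewrite !actpermE /= /cayley_act !enum_rankK !mul1g.
  exact: enum_rank_inj.
apply/existsP; exists (actperm (cayley_action gT) @* G)%G.
exact: sub_isog (subsetT G) inj.
Qed.

Definition mu (gT : finGroupType) (G : {group gT}) : nat :=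
  ex_minn (embeds_Sym_exists G).

(* minnormal M G only asks that G normalise M, hence the extra M \subset G *)
Definition Soc (gT : finGroupType) (G : {group gT}) : {set gT} :=
  <<\bigcup_(M : {group gT} | minnormal M G && (M \subset G)) M>>.

Definition CS (gT : finGroupType) (G : {group gT}) : bool :=
  (G :!=: 1) && (Soc G \subset 'Z(G)).

(* Main.v *)
Require Import Defs.
From mathcomp Require Import all_boot all_order all_fingroup all_solvable.
Import GroupScope.

(** Disjoint unions of permutation actions give
    [mu (G x H) <= mu G + mu H] ([mu_setX_le]).

    For the converse, a permutation action of a group [K] is, up to
    isomorphism, a list of point stabilisers, one for each orbit, and its degree
    is the sum of their indices.  The elements of prime order in the centre
    generate ['Ohm_1('Z(K))].  When the socle of [K] is central, an action of
    [K] is faithful as soon as it is faithful on this subgroup ([CS_injm]), that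
    is, as soon as the stabilisers meet it trivially in common.

    Take a faithful action of [K = G x H] of least degree.  Its stabilisers may
    be replaced, without increasing the degree, by subgroups that contain
    [S = 'Ohm_1('Z(K))] or meet it in a subgroup of prime index
    ([corank_le1_refine]): a stabiliser [L] for which this fails is exchanged for
    two larger subgroups that meet in [L].  Now [S] is the direct product of
    ['Ohm_1('Z(G))] and ['Ohm_1('Z(H))], and the trace on [S] of each new
    subgroup, if proper, is the kernel of a character of prime order.  As with a
    spanning family of linear forms on a direct sum, the list can be divided
    into one part that separates ['Ohm_1('Z(G))] and another that separates
    ['Ohm_1('Z(H))] ([separates_split]).  The coset actions of [K] on the two
    parts then restrict to faithful actions of [G] and of [H], and their degrees
    add up to at most that of the action of [K] ([mu_le_degree]). *)

Set Implicit Arguments.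
Unset Strict Implicit.
Unset Printing Implicit Defensive.

(** * Families of subgroups separating a central subgroup *)

(** For a subgroup [S] of the centre this says that [S] lies in [T] or meets it
    in a subgroup of prime index; in this form the property passes at once to
    every subset of [S]. *)
Definition corank_le1 (gT : finGroupType) (S : {set gT}) (T : {group gT}) : Prop :=
  {in S, forall x, x \notin T -> S \subset T * <[x]>}.

(** The [Ls] are meant as the point stabilisers, one for each orbit, of a
    permutation action; on a central [S], separation says that [S] acts
    faithfully. *)
Definition separates (gT : finGroupType) (S : {set gT}) (Ls : seq {group gT}) : Prop :=
  {in S, forall x, {in Ls, forall L : {group gT}, x \in L} -> x = 1}.

Definition degree (gT : finGroupType) (K : {group gT}) (Ls : seq {group gT}) :=
  (\sum_(L <- Ls) #|K : L|)%N.

Lemma corank_le1S (gT : finGroupType) (S S' : {set gT}) (T : {group gT}) :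
  S' \subset S -> corank_le1 S T -> corank_le1 S' T.
Proof.
move=> sS'S rT x S'x T'x; apply: (subset_trans sS'S).
exact: rT (subsetP sS'S x S'x) T'x.
Qed.

Lemma mem_mulg_setI (gT : finGroupType) (A B T : {group gT}) (a b : gT) :
  A :&: B = 1 -> a \in A -> b \in B -> (a * b \in (A :&: T) * B) = (a \in T).
Proof.
move=> tiAB Aa Bb; apply/idP/idP=> [/mulsgP[a' b' /setIP[Aa' Ta'] Bb' eq_ab]|Ta].
  suff ->: a = a' by [].
  apply/eqP; rewrite eq_mulVg1 -in_set1 -set1gE -tiAB inE groupM ?groupV //=.
  suff ->: a^-1 * a' = b * b'^-1 by rewrite groupM ?groupV.
  by apply: (mulgI a); apply: (mulIg b'); rewrite mulKVg mulgA mulgKV.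
by rewrite mem_mulg // inE Aa.
Qed.

(** Suppose that [x] in [(A :&: T) * B] lies in every member of [Ts].  If [x] is
    not in [T], the corank condition writes [e = t * x ^+ k] with [t] in [T];
    then [t] lies in all of [T :: Ts], so [t = 1] and [e] is a power of [x],
    which is excluded.  Thus [A] can be cut down by [T] at the price of [T]
    itself. *)
Lemma separates_shrink {gT : finGroupType} {A B T : {group gT}} {Ts e} :
    A \subset 'C(B) -> corank_le1 (A * B) T ->
    separates (A * B) (T :: Ts) ->
    e \in A * B -> {in Ts, forall L : {group gT}, e \in L} ->
    e \notin (A :&: T) * B ->
  separates ((A :&: T) * B) Ts.
Proof.
move=> cAB rT sepT ABe Tse nTe x A'Bx Tsx.
have sA'B: (A :&: T) * B \subset A * B by rewrite mulSg ?subsetIl.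
have cA'B: A :&: T \subset 'C(B) by rewrite subIset ?cAB.
have ABx := subsetP sA'B x A'Bx.
have [Tx | T'x] := boolP (x \in T).
  by apply: sepT => // L; rewrite inE => /predU1P[-> | /Tsx].
have /mulsgP[t _ Tt /cycleP[k ->] def_e] := subsetP (rT x ABx T'x) e ABe.
have defJ := cent_joinEl cAB.
have A'Bxk: x ^+ k \in (A :&: T) * B.
  by move: A'Bx; rewrite -(cent_joinEl cA'B); apply: groupX.
have t1: t = 1.
  have def_t: t = e * x ^- k by rewrite def_e mulgK.
  apply: sepT => [|L].
    by move: ABe ABx; rewrite def_t -defJ => Je Jx; rewrite groupM ?groupV ?groupX.
  rewrite inE => /predU1P[-> // | TsL].
  by rewrite def_t groupM ?groupV ?groupX ?Tsx ?Tse.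
by rewrite def_e t1 mul1g A'Bxk in nTe.
Qed.

(** Induction on the list.  If the tail alone fails to separate [A * B], some
    nontrivial [e = a * b] lies in all of the tail, hence not in [T], so that [a]
    or [b] is outside [T].  In the first case [T] goes to the [A] side and [A] is
    replaced by [A :&: T]; the second is symmetric.  This is the basis exchange
    behind the Laplace expansion, for functionals on a direct sum, done for
    all primes at once. *)
Lemma separates_split (gT : finGroupType) (Ls : seq {group gT}) (A B : {group gT}) :
    A \subset 'C(B) -> A :&: B = 1 ->
    {in Ls, forall T, corank_le1 (A * B) T} -> separates (A * B) Ls ->
  exists Ls1 Ls2,
    [/\ perm_eq Ls (Ls1 ++ Ls2), separates A Ls1 & separates B Ls2].
Proof.
elim: Ls A B => [|T Ts IH] A B cAB tiAB rL sepL.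
  exists [::], [::]; split=> // x Xx _; apply: sepL => //.
    by rewrite -[x]mulg1 mem_mulg.
  by rewrite -[x]mul1g mem_mulg.
have rTs: {in Ts, forall L, corank_le1 (A * B) L}.
  by move=> L TsL; apply: rL; rewrite inE TsL orbT.
have rT: corank_le1 (A * B) T by apply: rL; rewrite mem_head.
case: (boolP [exists e in A * B, (e != 1) && all (fun L : {group gT} => e \in L) Ts]);
    last first.
  move=> noe.
  have [|Ls1 [Ls2 [eqLs sep1 sep2]]] := IH A B cAB tiAB rTs.
    move=> x ABx Tsx; apply: contraNeq noe => ntx.
    by apply/exists_inP; exists x => //; rewrite ntx; apply/allP.
  (* The tail already separates, so the side that receives [T] is arbitrary. *)
  exists (T :: Ls1), Ls2; split; rewrite /= ?perm_cons //.
  by move=> x Ax Lsx; apply: sep1 => // L Ls1L; apply: Lsx; rewrite inE Ls1L orbT.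
case/exists_inP=> e ABe /andP[nte /allP Tse].
have T'e: e \notin T.
  apply: contraNN nte => Te; apply/eqP/sepL => // L.
  by rewrite inE => /predU1P[-> | /Tse].
have /mulsgP[a b Aa Bb def_e] := ABe.
have [Ta | T'a] := boolP (a \in T); last first.
  have nA'Be: e \notin (A :&: T) * B by rewrite def_e mem_mulg_setI.
  have [||L TsL||Ls1 [Ls2 [eqLs sep1 sep2]]] := IH (A :&: T)%G B.
  - by rewrite subIset ?cAB.
  - by apply/trivgP; rewrite -tiAB setSI ?subsetIl.
  - by apply: corank_le1S (rTs L TsL); rewrite mulSg ?subsetIl.
  - exact: (separates_shrink cAB rT sepL ABe Tse nA'Be).
  exists (T :: Ls1), Ls2; split; rewrite /= ?perm_cons //.
  move=> x Ax Lsx; apply: sep1 => [|L Ls1L]; last by apply: Lsx; rewrite inE Ls1L orbT.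
  by rewrite inE Ax Lsx ?mem_head.
have T'b: b \notin T by apply: contra T'e => Tb; rewrite def_e groupM.
have cBA: B \subset 'C(A) by rewrite centsC.
have tiBA: B :&: A = 1 by rewrite setIC.
have eqAB: A * B = B * A by rewrite (centC cAB).
have nAB'e: e \notin (B :&: T) * A.
  by rewrite def_e (centsP cAB a Aa b Bb) mem_mulg_setI.
have eqAB': A * (B :&: T) = (B :&: T) * A.
  by rewrite (@centC _ A) // (subset_trans cAB) ?centS ?subsetIl.
have [||L TsL||Ls1 [Ls2 [eqLs sep1 sep2]]] := IH A (B :&: T)%G.
- by rewrite (subset_trans cAB) ?centS ?subsetIl.
- by apply/trivgP; rewrite -tiAB setIS ?subsetIl.
- by apply: corank_le1S (rTs L TsL); rewrite /= eqAB' eqAB mulSg ?subsetIl.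
- rewrite /= eqAB'; rewrite eqAB in rT sepL ABe.
  exact: (separates_shrink cBA rT sepL ABe Tse nAB'e).
exists Ls1, (T :: Ls2); split=> //.
  by rewrite perm_sym perm_catC /= perm_cons perm_catC perm_sym.
move=> x Bx Lsx; apply: sep2 => [|L Ls2L]; last by apply: Lsx; rewrite inE Ls2L orbT.
by rewrite inE Bx Lsx ?mem_head.
Qed.

(** * Reduction to subgroups of corank at most one *)

Lemma Ohm1_prime_gen (gT : finGroupType) (Z : {group gT}) :
  'Ohm_1(Z) = <<[set x in Z | prime #[x]]>>.
Proof.
apply/eqP; rewrite eqEsubset !gen_subG; apply/andP; split; apply/subsetP=> x.
  rewrite inE expn1 => /andP[Zx /eqP xp1].
  have [-> | ntx] := eqVneq x 1; first exact: group1.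
  apply: mem_gen; rewrite inE Zx.
  have p_pr: prime (pdiv #[x]) by rewrite pdiv_prime // order_gt1.
  by rewrite (nt_prime_order p_pr xp1 ntx).
rewrite inE => /andP[Zx p_pr]; apply: mem_gen.
by rewrite inE Zx expn1 (pdiv_id p_pr) expg_order /=.
Qed.

Lemma central_mulE (gT : finGroupType) (K L : {group gT}) x :
  L \subset K -> x \in 'Z(K) -> L <*> <[x]> = L * <[x]>.
Proof.
move=> sLK /centerP[_ cKx].
rewrite cent_joinEr // cycle_subG; apply/centP=> y /(subsetP sLK) Ky.
exact: cKx.
Qed.

(** The hypothesis makes [L <*> <[x]>] contain every central element of prime
    order, for any such [x] outside [L].  A power of [x] then links a given [z]
    outside [L] back to [x], since [<[x]>] has no proper nontrivial subgroup. *)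
Lemma corank_le1_prime (gT : finGroupType) (K L : {group gT})
    (X := [set x in 'Z(K) | prime #[x]]) : L \subset K ->
    {in X &, forall x y, x \notin L -> y \notin L -> x \in L <*> <[y]>} ->
  corank_le1 'Ohm_1('Z(K)) L.
Proof.
move=> sLK LX z Oz L'z.
have Zz: z \in 'Z(K) := subsetP (Ohm_sub 1 'Z(K)) z Oz.
have [x Xx L'x]: exists2 x, x \in X & x \notin L.
  apply/exists_inP; apply: contraR L'z => /exists_inPn LX'.
  apply: subsetP Oz; rewrite Ohm1_prime_gen gen_subG; apply/subsetP=> y /LX'.
  by rewrite negbK.
have sOLx: 'Ohm_1('Z(K)) \subset L <*> <[x]>.
  rewrite Ohm1_prime_gen gen_subG; apply/subsetP=> y Xy.
  have [Ly | L'y] := boolP (y \in L); last exact: LX.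
  exact: subsetP (joing_subl L <[x]>) y Ly.
have [Zx p_pr]: x \in 'Z(K) /\ prime #[x] by apply/andP; rewrite inE in Xx.
have Lz_x: x \in L <*> <[z]>.
  have := subsetP sOLx z Oz; rewrite (central_mulE sLK) //.
  move=> /mulsgP[l _ Ll /cycleP[k ->] def_z].
  rewrite -cycle_subG; apply: contraR L'z => /(prime_TIg p_pr) tix.
  suff xk1: x ^+ k = 1 by rewrite def_z xk1 mulg1.
  apply/set1gP; rewrite -tix inE mem_cycle -(mulKg l (x ^+ k)) -def_z.
  by rewrite groupM ?groupV ?mem_gen ?inE ?Ll ?cycle_id ?orbT.
rewrite -(central_mulE sLK) //; apply: subset_trans sOLx _.
by rewrite join_subG joing_subl cycle_subG.
Qed.

Lemma index_join_half (gT : finGroupType) (K L : {group gT}) x :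
  L \subset K -> x \in K -> x \notin L ->
  (#|K : L <*> <[x]>| * 2 <= #|K : L|)%N.
Proof.
move=> sLK Kx L'x.
have sLM: L \subset L <*> <[x]> := joing_subl _ _.
have sMK: L <*> <[x]> \subset K by rewrite join_subG sLK cycle_subG.
rewrite -(Lagrange_index sMK sLM) leq_mul2l indexg_gt1 join_subG subxx /=.
by rewrite cycle_subG L'x orbT.
Qed.

(** If [L] has corank at least 2, there are central [x] and [y] of prime order,
    outside [L], with [x] outside [L <*> <[y]>].  The subgroups [L <*> <[x]>] and
    [L <*> <[y]>] meet in [L], and each has index at most half that of [L], so
    replacing [L] by the pair does not increase the degree.  Iterate. *)
Lemma corank_le1_refine (gT : finGroupType) (K L : {group gT}) : L \subset K ->
  exists Ms : seq {group gT},
    [/\ {in Ms, forall M, corank_le1 'Ohm_1('Z(K)) M},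
        (degree K Ms <= #|K : L|)%N
      & {in 'Ohm_1('Z(K)), forall z,
           {in Ms, forall M : {group gT}, z \in M} -> z \in L}].
Proof.
pose X := [set x in 'Z(K) | prime #[x]].
have [n] := ubnP #|K : L|; elim: n L => // n IH L lt_n sLK.
have [/exists_inP[x Xx /exists_inP[y Xy]] | noXY] :=
  boolP [exists x in X, exists y in X,
           [&& x \notin L, y \notin L & x \notin L <*> <[y]>]];
    last first.
  exists [:: L]; split=> [M||z _ ->]; rewrite ?inE //.
    move=> /eqP->; apply: corank_le1_prime => // x y Xx Xy L'x L'y.
    apply: contraR noXY => LXx; apply/exists_inP; exists x => //.
    by apply/exists_inP; exists y; rewrite ?L'x ?L'y.
  by rewrite /degree big_seq1.
case/and3P=> L'x L'y L'xy.
have [Zx px]: x \in 'Z(K) /\ prime #[x] by apply/andP; rewrite inE in Xx.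
have [Zy py]: y \in 'Z(K) /\ prime #[y] by apply/andP; rewrite inE in Xy.
have Kx: x \in K by case/centerP: Zx.
have Ky: y \in K by case/centerP: Zy.
have dx := index_join_half sLK Kx L'x; have dy := index_join_half sLK Ky L'y.
have lt_half m : (m * 2 <= #|K : L|)%N -> (m < n)%N.
  rewrite muln2 -addnn => le_m; rewrite -ltnS; apply: leq_trans lt_n.
  rewrite !ltnS; case: m le_m => [|m] le_m; first exact: indexg_gt0.
  by apply: leq_trans le_m; rewrite addSn addnS !ltnS leq_addl.
have [||Mx [rMx dMx sMx]] := IH (L <*> <[x]>)%G; first exact: lt_half.
  by rewrite join_subG sLK cycle_subG.
have [||My [rMy dMy sMy]] := IH (L <*> <[y]>)%G; first exact: lt_half.
  by rewrite join_subG sLK cycle_subG.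
exists (Mx ++ My); split.
- by move=> M; rewrite mem_cat => /orP[/rMx | /rMy].
- rewrite /degree big_cat /=; apply: leq_trans (leq_add dMx dMy) _.
  by rewrite -(leq_pmul2r (isT : 0 < 2)%N) mulnDl (muln2 #|K : L|) -addnn leq_add.
move=> z Oz Mz.
have: z \in L <*> <[x]> by apply: sMx => // M MxM; rewrite Mz // mem_cat MxM.
have: z \in L <*> <[y]> by apply: sMy => // M MyM; rewrite Mz // mem_cat MyM orbT.
move=> Lyz; rewrite (central_mulE sLK) // => /mulsgP[l _ Ll /cycleP[k ->] def_z].
have tix : <[x]> :&: (L <*> <[y]>) = 1 by rewrite prime_TIg ?cycle_subG.
suff xk1: x ^+ k = 1 by rewrite def_z xk1 mulg1.
apply/set1gP; rewrite -tix inE mem_cycle -(mulKg l (x ^+ k)) -def_z /=.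
by rewrite groupM // groupV mem_gen // inE Ll.
Qed.

Lemma corank_le1_refine_seq (gT : finGroupType) (K : {group gT})
    (Ls : seq {group gT}) :
    {in Ls, forall L : {group gT}, L \subset K} ->
    separates 'Ohm_1('Z(K)) Ls ->
  exists Ms : seq {group gT},
    [/\ {in Ms, forall M, corank_le1 'Ohm_1('Z(K)) M},
        (degree K Ms <= degree K Ls)%N & separates 'Ohm_1('Z(K)) Ms].
Proof.
move=> sLK sepL; suff [Ms [rM dM sM]]: exists Ms : seq {group gT},
    [/\ {in Ms, forall M, corank_le1 'Ohm_1('Z(K)) M},
        (degree K Ms <= degree K Ls)%N
      & {in 'Ohm_1('Z(K)), forall z, {in Ms, forall M : {group gT}, z \in M} ->
           {in Ls, forall L : {group gT}, z \in L}}].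
  by exists Ms; split=> // z Oz /sM-/(_ Oz); apply: sepL.
elim: Ls sLK {sepL} => [|L Ls IH] sLK; first by exists [::].
have [|Ms [rMs dMs sMs]] := IH; first by move=> M LsM; rewrite sLK // inE LsM orbT.
have [Ns [rNs dNs sNs]] := corank_le1_refine (sLK L (mem_head _ _)).
exists (Ns ++ Ms); split.
- by move=> M; rewrite mem_cat => /orP[/rNs | /rMs].
- by rewrite /degree big_cat big_cons leq_add.
move=> z Oz NMz M; rewrite inE => /predU1P[-> | ].
  by apply: sNs => // N NsN; rewrite NMz // mem_cat NsN.
by apply: sMs => // N MsN; rewrite NMz // mem_cat MsN orbT.
Qed.

(** * Permutation representations and their stabilisers *)

(** Transports permutations of a finite type along its enumeration, so that
    degrees can be computed with sum types and subtypes. *)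
Definition reindex_act (T : finType) (i : 'I_#|T|) (p : {perm T}) : 'I_#|T| :=
  enum_rank (p (enum_val i)).

Lemma reindex_act1 (T : finType) : (@reindex_act T)^~ 1 =1 id.
Proof. by move=> i; rewrite /reindex_act perm1 enum_valK. Qed.

Lemma reindex_actM (T : finType) i : act_morph (@reindex_act T) i.
Proof. by move=> p q; rewrite /reindex_act enum_rankK permM. Qed.

Definition reindex_action (T : finType) :=
  TotalAction (@reindex_act1 T) (@reindex_actM T).

Lemma perm_rep_ord (gT : finGroupType) (G : {group gT}) (T : finType)
    (f : {morphism G >-> {perm T}}) :
  exists h : {morphism G >-> 'S_#|T|}, 'ker h = 'ker f.
Proof.
have hM: {in G &, {morph (fun x => actperm (reindex_action T) (f x)) : x y / x * y}}.
  by move=> x y Gx Gy; rewrite /= !morphM ?inE.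
exists (Morphism hM); apply/setP=> x; rewrite !inE /=; case: (x \in G) => //=.
apply/eqP/eqP=> [|->]; last by rewrite morph1.
move/permP=> fx1; apply/permP=> t; rewrite perm1.
have := fx1 (enum_rank t); rewrite actpermE /= /reindex_act enum_rankK perm1.
exact: enum_rank_inj.
Qed.

Definition sum_perm_fun (T U : finType) (p : {perm T}) (q : {perm U}) (v : T + U) :=
  match v with inl t => inl (p t) | inr u => inr (q u) end.

Lemma sum_perm_inj (T U : finType) (p : {perm T}) (q : {perm U}) :
  injective (sum_perm_fun p q).
Proof. by move=> [t|u] [t'|u'] //= [/perm_inj->]. Qed.

Definition sum_perm (T U : finType) (p : {perm T}) (q : {perm U}) :=
  perm (@sum_perm_inj T U p q).

Lemma sum_permM (T U : finType) (p p' : {perm T}) (q q' : {perm U}) :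
  sum_perm (p * p') (q * q') = sum_perm p q * sum_perm p' q'.
Proof. by apply/permP=> -[t|u]; rewrite permM !permE /= ?permM. Qed.

Lemma sum_perm_eq1 (T U : finType) (p : {perm T}) (q : {perm U}) :
  (sum_perm p q == 1) = (p == 1) && (q == 1).
Proof.
apply/eqP/andP=> [/permP pq1 | [/eqP-> /eqP->]]; last first.
  by apply/permP=> -[t|u]; rewrite permE /= !perm1.
split; apply/eqP/permP=> t.
  by have := pq1 (inl t); rewrite permE !perm1 => -[].
by have := pq1 (inr t); rewrite permE !perm1 => -[].
Qed.

Lemma perm_rep_sum (gT : finGroupType) (G : {group gT}) m n
    (f : {morphism G >-> 'S_m}) (g : {morphism G >-> 'S_n}) :
  exists h : {morphism G >-> 'S_(m + n)}, 'ker h = 'ker f :&: 'ker g.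
Proof.
have hM: {in G &, {morph (fun x => sum_perm (f x) (g x)) : x y / x * y}}.
  by move=> x y Gx Gy; rewrite /= !morphM // sum_permM.
have [h kerh] := perm_rep_ord (Morphism hM).
have def_mn: #|{: 'I_m + 'I_n}| = (m + n)%N by rewrite card_sum !card_ord.
rewrite def_mn in h kerh *; exists h; rewrite kerh.
apply/setP=> x; rewrite !inE /= sum_perm_eq1.
by case: (x \in G).
Qed.

Lemma perm_rep_coset (gT : finGroupType) (G L : {group gT}) :
  exists f : {morphism G >-> 'S_#|G : L|}, 'ker f \subset L.
Proof.
pose P := mem (rcosets L G).
pose sT := {X : {set gT} | P X}.
have sTcard : #|{: sT}| = #|G : L| by rewrite card_sig.
pose to := subaction sT 'Rs.
have sGto: G \subset subact_dom P 'Rs.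
  apply/subsetP=> x Gx; rewrite !inE /=; apply/subsetP=> _ /[1!inE] /rcosetsP[y Gy ->].
  by rewrite !inE /= rcosetE -rcosetM; apply/rcosetsP; exists (y * x); rewrite ?groupM.
have [h kerh] := perm_rep_ord (restrm_morphism sGto (actperm_morphism to)).
rewrite sTcard in h kerh; exists h; rewrite kerh.
apply/subsetP=> x /[!inE] /= /andP[Gx /eqP/permP tox].
have PL: P (L : {set gT}).
  by apply/rcosetsP; exists 1; rewrite ?group1 // mulg1.
have /(congr1 val) := tox (Sub (L : {set gT}) PL).
rewrite /restrm perm1 actpermE val_subact (subsetP sGto) //= rcosetE => <-.
exact: rcoset_refl.
Qed.

Lemma perm_rep_cosets (gT : finGroupType) (G : {group gT}) (Ls : seq {group gT}) :
  exists f : {morphism G >-> 'S_(degree G Ls)},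
    {in Ls, forall L : {group gT}, 'ker f \subset L}.
Proof.
elim: Ls => [|L Ls [g kerg]].
  by rewrite /degree big_nil; exists [morphism of @trivm _ 'S_0 G].
have [f kerf] := perm_rep_coset G L; have [h kerh] := perm_rep_sum f g.
rewrite /degree big_cons; exists h => M; rewrite kerh inE => /predU1P[-> | LsM].
  by rewrite subIset ?kerf.
by rewrite subIset // orbC kerg.
Qed.

(** Stabilisers of orbit representatives suffice to detect central elements: a
    central element fixing one point of an orbit fixes all of it. *)
Lemma stabilisers_separate (gT : finGroupType) (G : {group gT}) n
    (f : {morphism G >-> 'S_n}) : 'injm f ->
  exists Ls : seq {group gT},
    [/\ {in Ls, forall L : {group gT}, L \subset G}, (degree G Ls <= n)%N
      & separates 'Z(G) Ls].
Proof.
move=> injf; pose to := comp_action ('P)%act f.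
have sGD: G \subset f @*^-1 [set: 'S_n] by rewrite -sub_morphim_pre ?subsetT.
pose X := orbit_transversal to G [set: 'I_n].
have actG: [acts G, on [set: 'I_n] | to].
  by apply/subsetP=> x Gx; rewrite !inE Gx /=; apply/subsetP=> i; rewrite !inE.
have [_ _ Xeq Xto] := orbit_transversalP actG; rewrite -/X in Xeq Xto.
exists [seq ('C_G[x | to])%G | x <- enum X]; split.
- by move=> L /mapP[x _ ->]; apply: subsetIl.
- rewrite /degree big_map big_enum /=.
  rewrite (eq_bigr (fun x => #|orbit to G x|)) => [|x _]; last first.
    by rewrite card_orbit_in.
  rewrite -(big_imset (fun A : {set 'I_n} => #|A|)) /=; last first.
    by move=> x y Xx Xy eq_xy; apply/eqP; rewrite -Xeq // eq_xy orbit_refl.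
  have /and3P[_ tiO _] := orbit_partition actG.
  have /eqP-> : trivIset (orbit to G @: X).
    by apply: trivIsetS tiO; rewrite imsetS ?subsetT.
  by rewrite -[leqRHS]card_ord max_card.
move=> z /centerP[Gz cGz] Xz; apply/eqP; rewrite -in_set1 -set1gE -(trivgP injf).
rewrite !inE Gz /=; apply/eqP/permP=> i; rewrite perm1.
have [a Ga Xia] := Xto i (in_setT i).
have /setIP[_ stab_z] : z \in ('C_G[to i a | to])%G.
  by apply: Xz; apply/mapP; exists (to i a); rewrite ?mem_enum.
have := astab_act stab_z (set11 _).
rewrite /= /comp_act /aperm -permM -morphM // -(cGz a Ga) morphM // permM.
exact: perm_inj.
Qed.

(** * Minimal degrees *)

Lemma mu_embeds (gT : finGroupType) (G : {group gT}) :
  (0 < mu G)%N /\ embeds_Sym G (mu G).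
Proof. by apply/andP; rewrite /mu; case: ex_minnP. Qed.

Lemma mu_le (gT : finGroupType) (G : {group gT}) n :
  G :!=: 1 -> embeds_Sym G n -> (mu G <= n)%N.
Proof.
move=> ntG Gn; rewrite /mu; case: ex_minnP => m _; apply; rewrite Gn andbT.
(* Degree 0 is impossible, as 'S_0 is trivial. *)
case: n Gn => // /existsP[K isoGK]; case/negP: ntG.
rewrite trivg_card_le1 (card_isog isoGK); apply: leq_trans (max_card _) _.
by rewrite card_Sn.
Qed.

(** A nontrivial kernel would contain a minimal normal subgroup; that one lies in
    the socle, hence in the centre, and so would meet ['Ohm_1('Z(G))]. *)
Lemma CS_injm (gT rT : finGroupType) (G : {group gT}) (f : {morphism G >-> rT}) :
  CS G -> 'ker f :&: 'Ohm_1('Z(G)) = 1 -> 'injm f.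
Proof.
case/andP=> _ sSZ /TI_Ohm1 tikZ; apply/idPn=> ntk.
have [||M minM sMk] := @minnormal_exists _ G ('ker f)%G.
- by rewrite -subG1.
- exact: normal_norm (ker_normal f).
have sMZ: M \subset 'Z(G).
  apply: subset_trans sSZ; apply: sub_gen.
  by rewrite (bigcup_max M) // minM (subset_trans sMk) ?subsetIl.
have [/andP[ntM _] _] := mingroupP minM; case/negP: ntM.
by rewrite -subG1 -tikZ subsetI sMk.
Qed.

(** The coset action of the big group [K] restricts to [G] along [phi]; by
    [CS_injm] it is faithful as soon as it is so on ['Ohm_1('Z(G))]. *)
Lemma mu_le_degree (gT rT : finGroupType) (G D : {group gT}) (K : {group rT})
    (phi : {morphism D >-> rT}) (Ls : seq {group rT}) :
    CS G -> 'injm phi -> G \subset D -> phi @* G \subset K ->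
    separates 'Ohm_1('Z(phi @* G)) Ls ->
  (mu G <= degree K Ls)%N.
Proof.
move=> csG injphi sGD sGK; rewrite -injm_center //.
rewrite -injm_Ohm ?(subset_trans (center_sub G)) // => sepL.
have [f kerf] := perm_rep_cosets K Ls.
have phiK x : x \in G -> phi x \in K.
  by move=> Gx; rewrite (subsetP sGK) ?mem_morphim // (subsetP sGD).
have hM: {in G &, {morph (fun x => f (phi x)) : x y / x * y}}.
  by move=> x y Gx Gy; rewrite /= !morphM ?phiK ?(subsetP sGD).
apply: mu_le; first by case/andP: csG.
apply/embeds_SymP; exists (Morphism hM); apply: CS_injm csG _.
apply/trivgP/subsetP=> x /setIP[kx Ox]; have Gx := dom_ker kx.
rewrite inE -(morph_injm_eq1 injphi) ?(subsetP sGD) //.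
apply/eqP; apply: sepL => [|L LsL].
  by rewrite mem_morphim ?(subsetP sGD).
apply: (subsetP (kerf L LsL)).
rewrite !inE phiK //=; by have /mker /= -> := kx.
Qed.

Lemma mu_setX_le (gT hT : finGroupType) (G : {group gT}) (H : {group hT}) :
  G :!=: 1 -> (mu (setX_group G H) <= mu G + mu H)%N.
Proof.
move=> ntG; have [_ /embeds_SymP[f injf]] := mu_embeds G.
have [_ /embeds_SymP[g injg]] := mu_embeds H.
have fM: {in setX G H &, {morph (fun u : gT * hT => f u.1) : x y / x * y}}.
  by move=> [x ?] [y ?] /setXP[Gx _] /setXP[Gy _]; rewrite /= morphM.
have gM: {in setX G H &, {morph (fun u : gT * hT => g u.2) : x y / x * y}}.
  by move=> [? x] [? y] /setXP[_ Hx] /setXP[_ Hy]; rewrite /= morphM.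
have [h kerh] := perm_rep_sum (@Morphism _ _ (setX_group G H) _ fM)
                              (@Morphism _ _ (setX_group G H) _ gM).
apply: mu_le.
  apply: contraNneq ntG => GH1; rewrite -subG1; apply/subsetP=> x Gx.
  have: (x, 1) \in setX G H by rewrite inE Gx group1.
  by move: GH1 => /= ->; rewrite inE => /eqP[->]; apply: set11.
apply/embeds_SymP; exists h; rewrite kerh; apply/subsetP=> -[x y] /setIP[kx ky].
have /setXP[/= Gx Hy] := dom_ker kx.
have /mker/= fx1 := kx; have /mker/= gy1 := ky.
rewrite inE; apply/eqP; congr (_, _).
  by apply/eqP; rewrite -(morph_injm_eq1 injf) // fx1.
by apply/eqP; rewrite -(morph_injm_eq1 injg) // gy1.
Qed.

Theorem lemma12 (gT hT : finGroupType) (G : {group gT}) (H : {group hT}) :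
  CS G -> CS H -> mu (setX_group G H) = (mu G + mu H)%N.
Proof.
move=> csG csH; apply/eqP; rewrite eqn_leq mu_setX_le; last by case/andP: csG.
set K := setX_group G H.
have [_ /embeds_SymP[f injf]] := mu_embeds K.
have [Ls [sLK dL sepZ]] := stabilisers_separate injf.
have sepO: separates 'Ohm_1('Z(K)) Ls.
  by move=> z /(subsetP (Ohm_sub _ _)); apply: sepZ.
have [Ms [rM dM sepM]] := corank_le1_refine_seq sLK sepO.
have [_ defO cO tiO] := dprodP (Ohm_dprod 1 (center_dprod (setX_dprod G H))).
have rAB: {in Ms, forall M, corank_le1 ('Ohm_1('Z(setX G 1)) * 'Ohm_1('Z(setX 1 H))) M}.
  by rewrite defO.
have [|Ms1 [Ms2 [eqM sep1 sep2]]] := separates_split (etrans (centsC _ _) cO) tiO rAB.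
  by rewrite defO.
apply: leq_trans dL; apply: leq_trans dM.
rewrite /degree (perm_big _ eqM) big_cat leq_add //=.
- apply: (mu_le_degree csG (injm_pairg1 gT hT)); rewrite ?subsetT ?morphim_pairg1 //.
  by rewrite setXS ?sub1set.
- apply: (mu_le_degree csH (injm_pair1g gT hT)); rewrite ?subsetT ?morphim_pair1g //.
  by rewrite setXS ?sub1set.
Qed.
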